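(* Let $I$ be a countable index set (could be finite), and let $\alpha: \bigoplus_{i\in I}\mathbb{Z}\curvearrowright X$ be a distal action on the Cantor set $X$ such that the free points of $\alpha$ are dense in $X$. Let $T$ be a finite symmetric subset of $[[\alpha]]$ and denote by $\Gamma=\langle T\rangle\leq [[\alpha]]$ the subgroup generated by $T$. Then there are positive integers $l, m, d, C$ depending only on $T$ such that for any $\epsilon>0$ one has $$\operatorname{F{\o}l}_{\Gamma, T}(\epsilon)\leq \left\lceil\frac{m}{1-(1-\epsilon/C)^{1/d}}\right\rceil^{dl}.$$ As a consequence, $\Gamma$ is of polynomial growth.
   Context: Actions are continuous, and $X$ carries a compatible metric $d(\cdot,\cdot)$ (not to be confused with the integer $d$ in the claim). An action $G\curvearrowright X$ is distal if $\inf_{g\in G}d(gx,gy)>0$ whenever $x\neq y$ in $X$. A point $x$ is free if its stabilizer is trivial. The topological full group $[[\alpha]]$ of an action $\alpha:G\curvearrowright X$ of a countable discrete group $G$ is the group of all homeomorphisms $\varphi: X\to X$ for which there is a continuous map $c: X\to G$ with $\varphi(x)=\alpha_{c(x)}(x)$ for all $x\in X$. For a group $\Gamma$ generated by a finite set $T$, the F{\o}lner function is $\operatorname{F{\o}l}_{\Gamma,T}(\epsilon)=\min\{|F|: F\subset \Gamma \text{ finite nonempty}, |\partial_T^-F|\leq \epsilon|F|\}$, where $\partial_T^-F=\{g\in F: Tg\cap (\Gamma\setminus F)\neq\emptyset\}$ is the interior boundary of $F$ with respect to $T$.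
   Formalization: For ε > C the quantity (1-ε/C)^{1/d} is a root of a negative number (undefined for even d), so 1-ε/C is replaced by max(0, 1-ε/C); the bound is unchanged for 0 < ε ≤ C, and for ε ≥ 1 the Følner function equals 1. *)

(* Defs.v *)
From HB Require Import structures.
From mathcomp Require Import all_boot all_order all_algebra finmap.
From mathcomp Require Import all_classical all_reals all_analysis.

Set Implicit Arguments.
Unset Strict Implicit.
Unset Printing Implicit Defensive.

Import Order.TTheory GRing.Theory Num.Theory.

Local Open Scope classical_set_scope.
Local Open Scope ring_scope.

Definition finsupp_fun (I : choiceType) : {pred I -> int} :=
  [pred f : I -> int | `[< finite_set [set i | f i != 0] >]].

Lemma finsupp_fun_zmod (I : choiceType) : zmod_closed (@finsupp_fun I).
Proof.
split=> [|f g]; rewrite !inE.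
  by apply: sub_finite_set (@finite_set0 I) => i /= /eqP.
move=> ff fg.
have fU : finite_set ([set i | f i != 0] `|` [set i | g i != 0]).
  by rewrite finite_setU.
apply: sub_finite_set fU => i; rewrite /= !fctE.
by have [->|fi _] := eqVneq (f i) 0; [rewrite sub0r oppr_eq0; right | left].
Qed.

HB.instance Definition _ (I : choiceType) :=
  GRing.isZmodClosed.Build (I -> int) (@finsupp_fun I) (@finsupp_fun_zmod I).

(* The direct sum of copies of Z indexed by I. *)
Record int_dsum (I : choiceType) := IntDsum {
  int_dsum_val :> I -> int ;
  _ : int_dsum_val \in @finsupp_fun I }.

HB.instance Definition _ (I : choiceType) := [isSub for @int_dsum_val I].
HB.instance Definition _ (I : choiceType) := [Choice of int_dsum I by <:].
HB.instance Definition _ (I : choiceType) :=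
  [SubChoice_isSubZmodule of int_dsum I by <:].

Definition homeomorphism (X Y : topologicalType) (f : X -> Y) : Prop :=
  continuous f /\
  exists g : Y -> X, [/\ continuous g, cancel f g & cancel g f].

Definition cantor_set (X : topologicalType) : Prop :=
  exists f : cantor_space -> X, homeomorphism f.

Section HomeoGroup.
Context (X : topologicalType).

Record homeo := Homeo {
  homeo_fun :> X -> X ;
  _ : `[< homeomorphism homeo_fun >] }.

HB.instance Definition _ := [isSub for homeo_fun].
HB.instance Definition _ := [Choice of homeo by <:].

Lemma homeoP (f : homeo) : homeomorphism f.
Proof. exact/asboolP/(valP f). Qed.

Lemma homeomorphism_id : homeomorphism (@id X).
Proof. by split=> [x|]; [|exists id; split=> // x]. Qed.

Lemma homeomorphism_comp (f g : homeo) : homeomorphism (f \o g).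
Proof.
have [fc [f' [f'c fK f'K]]] := homeoP f.
have [gc [g' [g'c gK g'K]]] := homeoP g.
split; first by move=> x; apply: continuous_comp; [exact: gc | exact: fc].
exists (g' \o f'); split; last 2 first.
- exact: can_comp.
- exact: can_comp.
- by move=> x; apply: continuous_comp; [exact: f'c | exact: g'c].
Qed.

Definition homeo_inv_fun (f : homeo) : X -> X := sval (cid (homeoP f).2).

Lemma homeo_inv_funP (f : homeo) :
  [/\ continuous (homeo_inv_fun f), cancel f (homeo_inv_fun f)
    & cancel (homeo_inv_fun f) f].
Proof. exact: (svalP (cid (homeoP f).2)). Qed.

Lemma homeomorphism_inv (f : homeo) : homeomorphism (homeo_inv_fun f).
Proof.
have [gc fK gK] := homeo_inv_funP f.
by split=> //; exists f; split=> //; have [] := homeoP f.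
Qed.

Definition homeo_one := Homeo (asboolT homeomorphism_id).
Definition homeo_mul f g := Homeo (asboolT (homeomorphism_comp f g)).
Definition homeo_inv f := Homeo (asboolT (homeomorphism_inv f)).

Lemma homeo_mulA : associative homeo_mul.
Proof. by move=> f g h; apply: val_inj. Qed.
Lemma homeo_mul1 : left_id homeo_one homeo_mul.
Proof. by move=> f; apply: val_inj. Qed.
Lemma homeo_mulr1 : right_id homeo_one homeo_mul.
Proof. by move=> f; apply: val_inj. Qed.
Lemma homeo_mulV : left_inverse homeo_one homeo_inv homeo_mul.
Proof.
by move=> f; apply/val_inj/funext => x /=; have [_ fK _] := homeo_inv_funP f.
Qed.
Lemma homeo_mulrV : right_inverse homeo_one homeo_inv homeo_mul.
Proof.
by move=> f; apply/val_inj/funext => x /=; have [_ _ gK] := homeo_inv_funP f.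
Qed.

HB.instance Definition _ := isGroup.Build homeo
  homeo_mulA homeo_mul1 homeo_mulr1 homeo_mulV homeo_mulrV.

End HomeoGroup.

(* G is discrete, so continuity of the action map amounts to that of each
   [alpha g]. *)
Definition continuous_action (G : zmodType) (X : topologicalType)
    (alpha : G -> X -> X) : Prop :=
  [/\ forall x, alpha 0 x = x,
      forall g h x, alpha (g + h) x = alpha g (alpha h x)
    & forall g, continuous (alpha g)].

Definition distal (R : realType) (G : zmodType) (X : metricType R)
    (alpha : G -> X -> X) : Prop :=
  forall x y : X, x != y ->
    0 < inf [set mdist (alpha g x) (alpha g y) | g in [set: G]].

Definition free_point (G : zmodType) (X : Type) (alpha : G -> X -> X)
    (x : X) : Prop :=
  [set g | alpha g x = x] = [set 0].

Definition full_group (G : zmodType) (X : topologicalType)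
    (alpha : G -> X -> X) : set (homeo X) :=
  [set phi | exists2 c : X -> discrete_topology G,
     continuous c & forall x, phi x = alpha (c x) x].

Section Folner.
Context (G : groupType).
Implicit Types (T F S : {fset G}) (Gam : set G).

Definition is_subgroup (H : set G) : Prop :=
  [/\ H 1%g, forall x y, H x -> H y -> H (x * y)%g
    & forall x, H x -> H (x^-1)%g].

Definition generated (A : set G) : set G := smallest is_subgroup A.

Definition symmetric_fset T : Prop := forall t, t \in T -> (t^-1)%g \in T.

Definition interior_boundary Gam T F : {fset G} :=
  [fset g in F |
    `[< [set (t * g)%g | t in [set` T]] `&` (Gam `\` [set` F]) !=set0 >]]%fset.

(* An infimum of natural numbers, hence a minimum when it is finite; it is +oo
   when no F qualifies. *)
Definition folner (R : realType) Gam T (eps : R) : \bar R :=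
  ereal_inf [set (#|` F|%:R)%:E | F in
    [set F : {fset G} | [/\ F != fset0, [set` F] `<=` Gam &
      #|` interior_boundary Gam T F|%:R <= eps * #|` F|%:R :> R]]].

Fixpoint word_ball S (n : nat) : {fset G} :=
  if n is n'.+1 then
    (word_ball S n' `|` [fset (s * g)%g | s in S, g in word_ball S n'])%fset
  else [fset 1%g]%fset.

(* The choice of the generating set S is immaterial. *)
Definition polynomial_growth Gam : Prop :=
  exists S, [/\ symmetric_fset S, generated [set` S] = Gam &
    exists a k : nat, forall n : nat, (0 < n)%N ->
      (#|` word_ball S n| <= a * n ^ k)%N].

End Folner.

(* Main.v *)
Require Import Defs.
From HB Require Import structures.
From mathcomp Require Import all_boot all_order all_algebra finmap.
From mathcomp Require Import all_classical all_reals all_analysis.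
From mathcomp Require Import lra zify.

Set Implicit Arguments.
Unset Strict Implicit.
Unset Printing Implicit Defensive.

Import Order.TTheory GRing.Theory Num.Theory.

Local Open Scope classical_set_scope.
Local Open Scope ring_scope.

(** Write G for the acting group and choose, for each t in T, a continuous
cocycle c_t with t x = c_t(x) x. As X is compact, these cocycles take finitely
many values; let K be a finite symmetric set containing 0 and all of them, and
H the subgroup that K generates.

The heart of the matter is that a distal action of a finitely generated group
on a zero-dimensional compact space is equicontinuous (Auslander, Glasner and
Weiss). What is needed of it is [invariant_refinement]: the clopen partition
of X into the level sets of x |-> (c_t(x))_t has a finite clopen refinement
whose pieces are permuted by K. Suppose not. Then for each j there are two
points whose names differ, but agree along a whole translate of the j-ball of
H by an element of the (j+1)-ball; by compactness a single pair (x, y) serves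
for all j. A limit p of the translations, taken in the enveloping semigroup of H
(the closure of H in X^X), gives h p x and h p y the same name for all h in H.
Distality makes p left invertible in that semigroup
([enveloping_left_inverse]), so that x and y have the same name too, which is
a contradiction. Left invertibility comes from the Ellis-Numakura theorem: the
left ideal of p contains an idempotent u, and as u moves x and u x to the same
point, distality forces u = id.

Polynomial growth follows by counting. A word of length n in T has a cocycle
that is constant on each of the q pieces of the refinement and takes values in
the n-ball of H with respect to K; since H is abelian this ball has at most
(n + 1) ^ #|K| elements, so there are at most (n + 1) ^ (#|K| * q) such words
([full_group_growth]).

The bound on the Folner function is then a general fact on groups of polynomial
growth ([folner_of_growth]), obtained with d = C = 1: if no ball of radius at
most L satisfied the Folner condition for eps, balls would grow by a factor
1 + eps at each step up to radius L; taking L of order eps^(-2) this exceeds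
any given polynomial in L, and a ball of radius at most L has size polynomial
in 1 / eps. *)

(** * Idempotents in closed semigroups of self-maps *)

Lemma closure_sub_closed (T : topologicalType) (A B : set T) :
  A `<=` B -> closed B -> closure A `<=` B.
Proof. by move=> AB /closure_id ->; exact: closureS. Qed.

Lemma compact_directed_bigcap (T : topologicalType) (I : Type)
    (D : set I) (f : I -> set T) :
  compact [set: T] -> D !=set0 ->
  (forall i j, D i -> D j -> exists2 k, D k & f k `<=` f i `&` f j) ->
  (forall i, D i -> closed (f i)) -> (forall i, D i -> f i !=set0) ->
  \bigcap_(i in D) f i !=set0.
Proof.
move=> Tco [i0 Di0] fD fcl fn0.
have FF : ProperFilter (filter_from D f).
  by apply: filter_from_proper => //; apply: filter_from_filter; [exists i0|].
have [|p [_]] := Tco (filter_from D f) FF; first exact: filterT.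
rewrite clusterE => pcl; exists p => i Di.
rewrite (closure_id (f i)).1; last exact: fcl.
by apply: pcl; exists i.
Qed.

Section SelfMaps.
Context (X : uniformType).
Notation XX := {ptws X -> X}.

(** For pointwise convergence, composition is continuous in its left argument,
and in its right argument only when the left one is a continuous map; hence the
one-sided lemmas below. *)
Definition comp_maps (p q : XX) : XX := fun x => p (q x).

Lemma compact_maps : compact [set: X] -> compact [set: XX].
Proof.
move=> Xco; have := @tychonoff X (fun=> X) (fun=> setT) (fun=> Xco).
by congr (compact _); rewrite eqEsubset.
Qed.

Lemma continuous_eval (x : X) : continuous (fun p : XX => p x).
Proof. exact: (@proj_continuous X (fun=> X) x). Qed.

Lemma comp_maps_continuousl (a : XX) : continuous (comp_maps^~ a).
Proof.
move=> p.
apply/(@pointwise_cvgP X X (comp_maps^~ a @ p) _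
  (fmap_filter _ (nbhs_filter p))) => x.
exact: (@continuous_eval (a x) p).
Qed.

Lemma comp_maps_continuousr (h : XX) :
  continuous (h : X -> X) -> continuous (comp_maps h).
Proof.
move=> hc p.
apply/(@pointwise_cvgP X X (comp_maps h @ p) _
  (fmap_filter _ (nbhs_filter p))) => x.
by apply: continuous_comp; [exact: (@continuous_eval x p)|exact: hc].
Qed.

Definition map_semigroup (S : set XX) :=
  [/\ closed S, S !=set0 & forall p q, S p -> S q -> S (comp_maps p q)].

(** Zorn's lemma for inclusion of complements: the intersection of a chain of
closed subsemigroups is not empty, by compactness. Complements are taken in
[S], so that the empty chain is bounded by [S] itself. *)
Lemma map_semigroup_min (S : set XX) : compact [set: X] ->
  map_semigroup S ->
  exists2 M, M `<=` S /\ map_semigroup M &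
    forall N, N `<=` M -> map_semigroup N -> N = M.
Proof.
move=> Xco semiS.
pose P (C : set XX) := map_semigroup (S `\` C).
have [F FP Ftot|C [PC Cmax]] := @Zorn_bigcup XX P; last first.
  exists (S `\` C); first by split=> // p [].
  move=> N NC semiN; apply/seteqP; split=> // p [Sp Cp].
  apply: contrapT => Np; apply: (Cmax (C `|` ~` N)).
    by split; [left | move=> /(_ p (or_intror Np))].
  rewrite /P; suff -> : S `\` (C `|` ~` N) = N by [].
  (* the complement of the union is N, since N avoids C *)
  apply/seteqP; split=> [q [_ nCNq]|q Nq].
    by apply: contrapT => Nq; apply: nCNq; right.
  by have [Sq Cq] := NC _ Nq; split=> // -[].
have [->|/set0P F0] := eqVneq F set0.
  by rewrite /P bigcup_set0 setD0.
have eD : S `\` \bigcup_(C in F) C = \bigcap_(C in F) (S `\` C).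
  apply/seteqP; split=> [p [Sp nC] C FC|p pC].
    by split=> // Cp; apply: nC; exists C.
  have [C FC] := F0; split=> [|[D FD Dp]]; first by have [] := pC _ FC.
  by have [] := pC _ FD.
rewrite /P eD; split.
- by apply: closed_bigI => C /FP[].
- apply: compact_directed_bigcap => //; first exact: compact_maps.
  + move=> C D FC FD; have [CD|DC] := Ftot C D FC FD.
      by exists D => // p [Sp Dp]; split; split=> // /CD.
    by exists C => // p [Sp Cp]; split; split=> // /DC.
  + by move=> C /FP[].
  + by move=> C /FP[].
- by move=> p q pF qF C FC; have [_ _] := FP _ FC; apply; [exact: pF|exact: qF].
Qed.

(** In a minimal closed subsemigroup M, both M a and the set of those b in M
with b a = a are closed subsemigroups, hence equal to M: the first equality
shows that the second set is not empty, the second one gives a a = a. *)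
Lemma ellis_numakura (S : set XX) : hausdorff_space X -> compact [set: X] ->
  map_semigroup S -> exists2 u, S u & comp_maps u u = u.
Proof.
move=> Xh Xco /(map_semigroup_min Xco)[M [MS [Mcl [a Ma] MM]] Mmin].
have XXh : hausdorff_space XX by apply: hausdorff_product.
have XXco := compact_maps Xco.
have MaM : (comp_maps^~ a) @` M = M.
  apply: Mmin => [_ [p Mp <-]|]; first exact: MM.
  split; last 2 first.
  - by exists (comp_maps a a), a.
  - move=> _ _ [p Mp <-] [q Mq <-]; exists (comp_maps (comp_maps p a) q) => //.
    by apply: (MM) => //; apply: (MM).
  - apply: compact_closed => //; apply: continuous_compact.
      exact/continuous_subspaceT/comp_maps_continuousl.
    exact: subclosed_compact XXco _.
have [b Mb ba] : ((comp_maps^~ a) @` M) a by rewrite MaM.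
have NM : M `&` [set b | comp_maps b a = a] = M.
  apply: Mmin => [p []//|]; split; last 2 first.
  - by exists b.
  - move=> p q [Mp pa] [Mq qa]; split; first exact: MM.
    exact: etrans (congr1 (comp_maps p) qa) pa.
  - apply: closedI => //.
    have cl_a : closed [set a].
      exact/accessible_closed_set1/hausdorff_accessible.
    apply: (@preimage_closed _ _ (comp_maps^~ a) _ _ cl_a).
    by move=> p _; exact: comp_maps_continuousl.
by exists a; [exact: MS | move: Ma; rewrite -NM => -[]].
Qed.

End SelfMaps.

Arguments comp_maps {X} p q.

(** * Locally constant functions *)

(** Continuity for the discrete topology on [N], without any structure on
[N]. *)
Definition locally_constant (T : topologicalType) (N : Type) (f : T -> N) :=
  forall x, \forall y \near x, f y = f x.

Section LocallyConstant.
Context (T : topologicalType).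

Lemma locally_constant_closed (N : Type) (f : T -> N) (A : set N) :
  locally_constant f -> closed (f @^-1` A).
Proof.
move=> fc; rewrite -[_ @^-1` _]setCK; apply: open_closedC.
rewrite openE => x /= nAx.
by apply: filterS (fc x) => y /= fy; rewrite /setC /= fy.
Qed.

Lemma locally_constant_comp (U : topologicalType) (N : Type) (f : T -> N)
    (g : U -> T) :
  continuous g -> locally_constant f -> locally_constant (f \o g).
Proof. by move=> gc fc x; exact: (gc x _ (fc (g x))). Qed.

Lemma locally_constant_pair (M N : Type) (f : T -> M) (g : T -> N) :
  locally_constant f -> locally_constant g ->
  locally_constant (fun x => (f x, g x)).
Proof. by move=> fc gc x; apply: filterS2 (fc x) (gc x) => y -> ->. Qed.

Lemma locally_constant_map (I : Type) (N : Type) (s : seq I)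
    (f : I -> T -> N) :
  (forall i, locally_constant (f i)) ->
  locally_constant (fun x => [seq f i x | i <- s]).
Proof.
move=> fc; elim: s => [|i s IHs] x /=; first exact: nearW.
by apply: filterS2 (fc i x) (IHs x) => y -> ->.
Qed.

(** If the range were infinite, the sets whose complement has a finite image
would form a proper filter; near a cluster point [f] takes a single value, so
this neighbourhood does not meet one of the sets of the filter. *)
Lemma locally_constant_finite (N : Type) (f : T -> N) :
  compact [set: T] -> locally_constant f -> finite_set (range f).
Proof.
move=> Tco fc; apply: contrapT => infr.
pose F : set_system T := [set A | finite_set (f @` ~` A)].
have FF : ProperFilter F.
  split; first by rewrite /F /= setC0.
  split; first by rewrite /F /= setCT image_set0.
    by move=> A B FA FB; rewrite /F /= setCI image_setU finite_setU.
  move=> A B AB; rewrite /F /=; apply: sub_finite_set.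
  by apply: image_subset => x nBx /AB.
have [|x [_ clx]] := Tco F FF; first exact: filterT.
have Fx : F (~` (f @^-1` [set f x])).
  rewrite /F /= setCK; apply: sub_finite_set (finite_set1 (f x)).
  by move=> _ [y /= -> <-].
by have [y []] := clx _ _ Fx (fc x).
Qed.

End LocallyConstant.

(** * The enveloping semigroup of a distal action *)

Section Enveloping.
Context (R : realType) (X : metricType R) (G : zmodType).
Context (alpha : G -> X -> X) (H : set G).
Hypothesis Xco : compact [set: X].
Hypothesis act : continuous_action alpha.
Hypothesis dist : distal alpha.
Hypothesis HD : forall g h, H g -> H h -> H (g + h).
Notation XX := {ptws X -> X}.

(** The Ellis semigroup of the action of [H]. *)
Definition enveloping : set XX := closure [set (alpha h : XX) | h in H].

Lemma enveloping_gen h : H h -> enveloping (alpha h).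
Proof. by move=> Hh; apply: subset_closure; exists h. Qed.

Lemma enveloping_sub (A : set XX) :
  closed A -> (forall h, H h -> A (alpha h)) -> enveloping `<=` A.
Proof.
by move=> Acl HA; apply: closure_sub_closed => // _ [h Hh <-]; exact: HA.
Qed.

(** Two passages to the limit, and their order matters: first in the right
factor, with the left one an element of [H], as composition on the left with
[alpha h] is continuous; then in the left factor. *)
Lemma enveloping_comp p q :
  enveloping p -> enveloping q -> enveloping (comp_maps p q).
Proof.
have [_ aD ac] := act; have Ecl : closed enveloping by exact: closed_closure.
move=> Ep Eq.
suff : enveloping `<=` (comp_maps^~ q) @^-1` enveloping by exact.
apply: enveloping_sub => [|h Hh].
  by apply: preimage_closed => // a _; exact: comp_maps_continuousl.
suff : enveloping `<=` (@comp_maps X (alpha h)) @^-1` enveloping by exact.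
apply: enveloping_sub => [|k Hk].
  apply: preimage_closed => // a _; apply: comp_maps_continuousr.
  exact: ac.
rewrite /preimage /=; have -> : comp_maps (alpha h) (alpha k) = alpha (h + k).
  by apply/funext => x; rewrite aD.
by apply: enveloping_gen; exact: HD.
Qed.

(** As u x = u (u x), elements of [H] close to u bring x and u x arbitrarily
close to each other. *)
Lemma distal_idempotent u : enveloping u -> comp_maps u u = u -> u = id.
Proof.
move=> Eu uu; apply/funext => x; apply/eqP/negPn/negP => uxx.
have uux : u (u x) = u x by rewrite -[in RHS]uu.
have inf_gt0 := dist uxx.
set m := inf _ in inf_gt0.
have m2 : 0 < m / 2 by rewrite divr_gt0.
have nb z : \forall q \near (u : XX), mdist (u z) (q z) < m / 2.
  have uz : \forall q \near (u : XX), ball (u z) (m / 2) (q z).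
    exact: (@continuous_eval X z u _ (nbhsx_ballx (u z) _ m2)).
  apply: (@filterS _ _ (nbhs_filter (u : XX)) _ _ _ uz) => q /=.
  by rewrite ballEmdist.
have [_ [[h Hh <-] /= [hx hux]]] :=
  Eu _ (@filterI _ _ (nbhs_filter (u : XX)) _ _ (nb x) (nb (u x))).
have : m <= mdist (alpha h (u x)) (alpha h x).
  have lb : has_lbound [set mdist (alpha g (u x)) (alpha g x) | g in [set: G]].
    by exists 0 => _ [g _ <-]; exact: mdist_ge0.
  by apply: (ge_inf lb); exists h.
apply/negP; rewrite -ltNge.
apply: le_lt_trans (metric_triangle _ (u x) _) _.
by rewrite [m]splitr ltrD// metric_sym -[X in mdist X _]uux.
Qed.

(** The left ideal of [p] is a closed semigroup, as the image of a compact set,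
and its idempotents are the identity. *)
Lemma enveloping_left_inverse p : enveloping p ->
  exists2 q, enveloping q & comp_maps q p = id.
Proof.
move=> Ep.
have XXh : hausdorff_space XX.
  by apply: hausdorff_product => _; exact: (@metric_hausdorff R X).
have [|_ [q Eq <-] qp] :=
    @ellis_numakura X ((comp_maps^~ p) @` enveloping)
      (@metric_hausdorff R X) Xco.
  split.
  - apply: compact_closed => //; apply: continuous_compact.
      exact/continuous_subspaceT/comp_maps_continuousl.
    apply: subclosed_compact (compact_maps Xco) _ => //.
    exact: closed_closure.
  - by exists (comp_maps p p), p.
  - move=> _ _ [a Ea <-] [b Eb <-]; exists (comp_maps (comp_maps a p) b) => //.
    by do 2!apply: enveloping_comp => //.
by exists q => //; apply: distal_idempotent qp; exact: enveloping_comp.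
Qed.

(** A limit of the action does not forget names: apply to [p x] and [p y] the
left inverse of [p], itself a limit of elements of [H]. *)
Lemma distal_separation (N : Type) (nu : X -> N) p x y :
  locally_constant nu -> enveloping p ->
  (forall h, H h -> nu (alpha h (p x)) = nu (alpha h (p y))) -> nu x = nu y.
Proof.
move=> nuc /enveloping_left_inverse[q Eq qp] agree.
have idE z : q (p z) = z by rewrite -[RHS]/(id z) -qp.
rewrite -(idE x) -(idE y).
suff : enveloping `<=`
    (fun r : XX => (nu (r (p x)), nu (r (p y)))) @^-1` [set ab | ab.1 = ab.2].
  by move=> /(_ _ Eq).
apply: enveloping_sub => [|h Hh]; last exact: agree.
apply: locally_constant_closed; apply: locally_constant_pair.
  exact: (locally_constant_comp (@continuous_eval X (p x)) nuc).
exact: (locally_constant_comp (@continuous_eval X (p y)) nuc).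
Qed.

End Enveloping.

(** * Balls in finitely generated abelian groups *)

Section GrowthBalls.
Context (G : zmodType) (K : seq G).
Hypothesis K0 : 0 \in K.

Fixpoint sumball (n : nat) : seq G :=
  if n is n'.+1 then [seq k + g | k <- K, g <- sumball n'] else [:: 0].

Lemma sumballS k g n : k \in K -> g \in sumball n -> k + g \in sumball n.+1.
Proof. by move=> kK gn; apply: allpairs_f. Qed.

Lemma sumball_add m n g h :
  g \in sumball m -> h \in sumball n -> g + h \in sumball (m + n).
Proof.
elim: m g => [g|m IHm g /=]; first by rewrite inE => /eqP ->; rewrite add0r.
move=> /allpairsP[[k g'] /= [kK g'm ->]] hn; rewrite -addrA.
by apply: sumballS => //; exact: IHm.
Qed.

Lemma sumball_split m n g : g \in sumball (m + n) ->
  exists a b, [/\ a \in sumball m, b \in sumball n & g = a + b].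
Proof.
elim: m g => [|m IHm] g /=.
  by move=> gn; exists 0, g; rewrite inE add0r.
move=> /allpairsP[[k g'] /= [kK /IHm[a [b [am bn ->]]] ->]].
by exists (k + a), b; split; [exact: sumballS | | rewrite addrA].
Qed.

Lemma sumball0 n : 0 \in sumball n.
Proof.
by elim: n => [|n IHn]; rewrite ?inE// -[0]addr0; exact: sumballS.
Qed.

Lemma sumball_le m n g : (m <= n)%N -> g \in sumball m -> g \in sumball n.
Proof.
by move=> /subnKC <- gm; rewrite -[g]addr0; apply: sumball_add (sumball0 _).
Qed.

Lemma sumball_opp n g :
  (forall k, k \in K -> - k \in K) -> g \in sumball n -> - g \in sumball n.
Proof.
move=> KN; elim: n g => [g|n IHn g]; first by rewrite !inE oppr_eq0.
move=> /allpairsP[[k h] /= [kK hn ->]]; rewrite opprD.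
by apply: sumballS; [exact: KN|exact: IHn].
Qed.

(** The element with multiplicities [m] over the generators. Commutativity
makes these suffice for the ball of radius [n], which therefore has polynomial
size. *)
Definition multsum n (m : {ffun 'I_(size K) -> 'I_n.+1}) : G :=
  \sum_(i < size K) K`_i *+ m i.

Lemma sumball_multsum n g : g \in sumball n ->
  exists m : {ffun 'I_(size K) -> 'I_n.+1}, g = multsum m.
Proof.
elim: n g => [g|n IHn g].
  rewrite inE => /eqP ->; exists [ffun=> ord0].
  by rewrite /multsum big1// => i _; rewrite ffunE.
move=> /allpairsP[[k h] /= [kK /IHn[m ->] ->]].
have kO : (index k K < size K)%N by rewrite index_mem.
pose j := Ordinal kO.
exists [ffun i => inord (m i + (i == j))]; rewrite /multsum.
have -> : k = \sum_(i < size K) K`_i *+ (i == j).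
  rewrite (bigD1 j)//= eqxx mulr1n big1 ?addr0 ?nth_index//.
  by move=> i /negPf ->.
rewrite addrC -big_split; apply: eq_bigr => i _ /=.
rewrite ffunE inordK ?mulrnDr//.
rewrite ltnS; apply: (@leq_trans (n + 1)); last by rewrite addn1.
by rewrite leq_add ?leq_b1// -ltnS.
Qed.

End GrowthBalls.

(** * Equicontinuity: invariant finite refinements *)

Section Refinement.
Context (R : realType) (X : metricType R) (G : zmodType).
Context (alpha : G -> X -> X) (K : seq G).
Hypothesis Xco : compact [set: X].
Hypothesis act : continuous_action alpha.
Hypothesis dist : distal alpha.
Hypothesis K0 : 0 \in K.
Hypothesis KN : forall k, k \in K -> - k \in K.
Context (N : choiceType) (nu : X -> N).
Hypothesis nuc : locally_constant nu.
Notation XX := {ptws X -> X}.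

Definition agree n x y :=
  forall h, h \in sumball K n -> nu (alpha h x) = nu (alpha h y).

(** Otherwise pairs that agree on the j-ball but not on the next one exist for
all j. Moved by an element g of the (j+1)-ball at which they disagree, they
have different names, yet agree on the j-ball translated by - g. The sets
[horo j] of such pairs decrease, so compactness yields a pair in all of them,
and the corresponding translations have a limit that contradicts
[distal_separation]. *)
Lemma agree_stabilizes : exists n, forall x y, agree n x y -> agree n.+1 x y.
Proof.
have [a0 aD ac] := act; apply: contrapT => nstab.
pose horo j : set (X * X) := [set z | nu z.1 <> nu z.2 /\
  exists2 s, s \in sumball K j.+1 & forall h, h \in sumball K j ->
    nu (alpha (h + s) z.1) = nu (alpha (h + s) z.2)].
have horo_anti i j : (i <= j)%N -> horo j `<=` horo i.
  move=> ij z [nuz [s]]; rewrite -(subnK (ij : (i.+1 <= j.+1)%N)) subSS.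
  (* s = a + b with b short enough for radius i, and h + b = (h - a) + s, where
     h - a is still in the ball of radius j *)
  move=> /sumball_split[a [b [aij bi ->]]] zs; split=> //; exists b => // h hi.
  have -> : h + b = (h - a) + (a + b) by rewrite addrA subrK.
  apply: zs; rewrite -(subnKC ij); apply: sumball_add => //.
  exact: sumball_opp.
have horo_closed j : closed (horo j).
  have nuc2 g : locally_constant
      (fun z : X * X => (nu (alpha g z.1), nu (alpha g z.2))).
    apply: locally_constant_pair.
      apply: (locally_constant_comp _ nuc) => z.
      by apply: continuous_comp; [exact: cvg_fst|exact: ac].
    apply: (locally_constant_comp _ nuc) => z.
    by apply: continuous_comp; [exact: cvg_snd|exact: ac].
  have -> : horo j =
      (fun z => (nu (alpha 0 z.1), nu (alpha 0 z.2))) @^-1`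
        [set ab | ab.1 <> ab.2] `&`
      \bigcup_(s in [set` sumball K j.+1]) \bigcap_(h in [set` sumball K j])
       (fun z => (nu (alpha (h + s) z.1), nu (alpha (h + s) z.2))) @^-1`
        [set ab | ab.1 = ab.2].
    by apply/seteqP; split=> z /=; rewrite /preimage /= !a0.
  apply: closedI; first exact: locally_constant_closed.
  apply: closed_bigcup => [|s _]; first exact: finite_seq.
  by apply: closed_bigI => h _; apply: locally_constant_closed.
have horo_nonempty j : horo j !=set0.
  have [x [y [xy nxy]]] : exists x y, agree j x y /\ ~ agree j.+1 x y.
    apply: contrapT => nxy; apply: nstab; exists j => x y xy.
    by apply: contrapT => nxy'; apply: nxy; exists x, y.
  have [g gj nuxy] : exists2 g, g \in sumball K j.+1 &
      nu (alpha g x) <> nu (alpha g y).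
    apply: contrapT => ng; apply: nxy => g gj.
    by apply: contrapT => nuxy; apply: ng; exists g.
  exists (alpha g x, alpha g y); split=> //.
  exists (- g); first exact: sumball_opp.
  by move=> h hj; rewrite -!aD subrK; exact: xy.
have [[x y] /= xyhoro] : \bigcap_(j in [set: nat]) horo j !=set0.
  apply: compact_directed_bigcap => //.
  - by rewrite -setXTT; exact: compact_setX.
  - move=> i j _ _; exists (maxn i j) => // z zij.
    by split; apply: horo_anti zij; rewrite (leq_maxl, leq_maxr).
have [nuxy _] := xyhoro 0%N I; apply: nuxy.
pose H := [set h | exists n, h \in sumball K n].
have HD g h : H g -> H h -> H (g + h).
  by move=> [m gm] [n hn]; exists (m + n)%N; exact: sumball_add.
(* A common point p of these sets, which distal_separation forbids, serves as a
   limit of the translations by the elements s. *)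
pose match_ j : set XX := enveloping alpha H `&`
  \bigcap_(h in [set` sumball K j])
    (fun p : XX => (nu (alpha h (p x)), nu (alpha h (p y)))) @^-1`
      [set ab | ab.1 = ab.2].
have [p pm] : \bigcap_(j in [set: nat]) match_ j !=set0.
  apply: compact_directed_bigcap => //.
  - exact: compact_maps.
  - move=> i j _ _; exists (maxn i j) => // p [Ep pm].
    split; split=> // h /= hi; apply: pm => /=; apply: sumball_le hi => //.
      exact: leq_maxl.
    exact: leq_maxr.
  - move=> j _; apply: closedI; first exact: closed_closure.
    apply: closed_bigI => h _; apply: locally_constant_closed.
    have nuhc : locally_constant (nu \o alpha h).
      exact: (locally_constant_comp (ac h) nuc).
    apply: locally_constant_pair.
      exact: (locally_constant_comp (@continuous_eval X x) nuhc).
    exact: (locally_constant_comp (@continuous_eval X y) nuhc).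
  - move=> j _; have [_ [s sj xys]] := xyhoro j I.
    exists (alpha s); split; first by apply: enveloping_gen; exists j.+1.
    by move=> h hj; rewrite /preimage /= -!aD; exact: xys.
apply: (@distal_separation _ _ _ alpha H Xco act dist HD N nu p) => //.
  by have [] := pm 0%N I.
by move=> h [n hn]; have [_] := pm n I; apply.
Qed.

(** [kappa x] is the list of names along the orbit of [x] up to the radius at
which agreement propagates. *)
Lemma invariant_refinement :
  exists (M : choiceType) (kappa : X -> M), finite_set (range kappa) /\
    forall x y, kappa x = kappa y -> nu x = nu y /\
      forall k, k \in K -> kappa (alpha k x) = kappa (alpha k y).
Proof.
have [n stab] := agree_stabilizes; have [a0 aD ac] := act.
pose kappa x := [seq nu (alpha h x) | h <- sumball K n].
have kappaP x y : kappa x = kappa y <-> agree n x y.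
  by rewrite /kappa /agree; split => [/eq_in_map|xy]; last exact/eq_in_map.
exists (seq N : choiceType), kappa; split.
  apply: locally_constant_finite => //; apply: locally_constant_map => h.
  exact: (locally_constant_comp (ac h) nuc).
move=> x y /kappaP xy; split.
  by have := xy 0; rewrite !a0; apply; exact: sumball0.
move=> k kK; apply/kappaP => h hn; rewrite -!aD.
by apply: stab => //; rewrite addrC; exact: sumballS.
Qed.

End Refinement.

(** * Polynomial growth in the topological full group *)

Lemma fset_card_inj (U : choiceType) (V : finType) (A : {fset U})
    (F : U -> V) :
  {in A &, injective F} -> (#|` A| <= #|V|)%N.
Proof.
move=> Finj; have uF : uniq [seq F u | u <- A] by rewrite map_inj_in_uniq.
by rewrite -(size_map F) -(card_uniqP uF) max_card.
Qed.

Section FullGroupGrowth.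
Context (R : realType) (X : metricType R) (G : zmodType).
Context (alpha : G -> X -> X) (T : {fset homeo X}).
Hypothesis Xco : compact [set: X].
Hypothesis act : continuous_action alpha.
Hypothesis dist : distal alpha.
Hypothesis TG : [set` T] `<=` full_group alpha.

Lemma full_group_cocycles : exists c : homeo X -> X -> G,
  (forall t, locally_constant (c t)) /\
  forall t, t \in T -> forall x, t x = alpha (c t x) x.
Proof.
have [t|c cP] := @choice _ _ (fun (t : homeo X) (c : X -> G) =>
    locally_constant c /\ (t \in T -> forall x, t x = alpha (c x) x)).
  have [tT|_] := boolP (t \in T); last first.
    by exists (fun=> 0); split=> // x; near=> y.
  have [c cc tc] := TG tT; exists c; split=> // x.
  exact: (cc x _ (discrete_set1 (c x))).
by exists c; split=> t; have [] := cP t.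
Unshelve. all: by end_near. Qed.

(** The cocycle identity c_(tg)(x) = c_t(g x) + c_g(x). Points with the same
[kappa] are moved by [g] through the same element of the ball, hence to points
with the same [kappa], on which c_t agrees. *)
Lemma word_ball_cocycle (K : seq G) (M : Type) (kappa : X -> M)
    (c : homeo X -> X -> G) :
  0 \in K ->
  (forall t, t \in T -> forall x, t x = alpha (c t x) x /\ c t x \in K) ->
  (forall x y, kappa x = kappa y ->
    (forall t, t \in T -> c t x = c t y) /\
    forall k, k \in K -> kappa (alpha k x) = kappa (alpha k y)) ->
  forall n (f : homeo X), f \in word_ball T n ->
    exists b : X -> G, [/\ forall x, f x = alpha (b x) x,
      forall x, b x \in sumball K n &
      forall x y, kappa x = kappa y -> b x = b y].
Proof.
have [a0 aD _] := act => K0 cT kc.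
have kball n g x y : g \in sumball K n -> kappa x = kappa y ->
    kappa (alpha g x) = kappa (alpha g y).
  elim: n g => [g|n IHn g]; first by rewrite inE => /eqP ->; rewrite !a0.
  move=> /allpairsP[[k h] /= [kK hn ->]] xy; rewrite !aD.
  by have [_] := kc _ _ (IHn _ hn xy); apply.
elim=> [f|n IHn f] /=.
  rewrite inE => /eqP ->; exists (fun=> 0).
  by split=> // x; rewrite ?a0// inE.
rewrite inE => /orP[/IHn[b [fb bn bk]]|].
  by exists b; split=> // x; exact: sumball_le (leqnSn n) (bn x).
move=> /imfset2P[t /= tT [g gn ->]]; have [b [gb bn bk]] := IHn _ gn.
exists (fun x => c t (g x) + b x); split=> [x|x|x y xy] /=.
- by rewrite aD -gb; have [] := cT _ tT (g x).
- by apply: sumballS => //; have [] := cT _ tT (g x).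
- rewrite (bk _ _ xy) gb (bk _ _ xy) gb; congr (_ + _).
  by have [+ _] := kc _ _ (kball _ _ _ _ (bn y) xy); apply.
Qed.

(** An element of the word ball is determined by the multiplicities that
represent its cocycle at one sample point [xs i] for each value of [kappa]. *)
Lemma full_group_growth : exists a k : nat, forall n : nat, (0 < n)%N ->
  (#|` word_ball T n| <= a * n ^ k)%N.
Proof.
have [c [cc cT]] := full_group_cocycles.
pose nu x := [seq c t x | t <- T].
have nuc : locally_constant nu by exact: locally_constant_map.
have /finite_seqP[vs vsE] := locally_constant_finite Xco nuc.
pose K := 0 :: flatten vs ++ [seq - g | g <- flatten vs].
have K0 : 0 \in K by rewrite inE eqxx.
have KN k : k \in K -> - k \in K.
  rewrite !inE oppr_eq0 !mem_cat => /orP[->//|/orP[kv|/mapP[g gv ->]]].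
    by rewrite [X in _ || (_ || X)]map_f ?orbT.
  by rewrite opprK gv orbT.
have cK t x : t \in T -> c t x \in K.
  move=> tT; rewrite inE mem_cat; apply/orP; right; apply/orP; left.
  apply/flattenP; exists (nu x); last by apply/mapP; exists t.
  by have : range nu (nu x) by []; rewrite vsE.
have [M [kappa [/finite_seqP[r rE] kP]]] :=
  invariant_refinement Xco act dist K0 KN nuc.
have [i|xs xsE] := @choice 'I_(size r) X
    (fun i x => kappa x = tnth (in_tuple r) i).
  have : [set` r] (tnth (in_tuple r) i) by exact: mem_tnth.
  by rewrite -rE => -[x _]; exists x.
have xsP x : exists i, kappa (xs i) = kappa x.
  have : range kappa (kappa x) by [].
  rewrite rE => /= /(@tnthP _ _ (in_tuple r))[i ->].
  by exists i; exact: xsE.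
have kc x y : kappa x = kappa y -> (forall t, t \in T -> c t x = c t y) /\
    forall k, k \in K -> kappa (alpha k x) = kappa (alpha k y).
  by move=> /kP[/eq_in_map nuxy kK]; split.
pose k := (size K * size r)%N.
exists (2 ^ k)%N, k => n n0.
have [f|F FP] := @choice (homeo X)
    {ffun 'I_(size r) -> {ffun 'I_(size K) -> 'I_n.+1}}
    (fun f F => f \in word_ball T n -> forall i x, kappa (xs i) = kappa x ->
       f x = alpha (multsum (F i)) x).
  have [fn|] := boolP (f \in word_ball T n); last first.
    by exists [ffun=> [ffun=> ord0]].
  have [|b [fb bn bk]] := word_ball_cocycle K0 _ kc fn.
    by move=> t tT x; split; [exact: cT|exact: cK].
  have [i|m mP] := @choice _ _ (fun i (m : {ffun 'I_(size K) -> 'I_n.+1}) =>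
      b (xs i) = multsum m); first exact: sumball_multsum.
  exists [ffun i => m i] => _ i x ix.
  by rewrite ffunE -mP fb (bk _ _ ix).
apply: (@leq_trans #|{ffun 'I_(size r) -> {ffun 'I_(size K) -> 'I_n.+1}}|).
  apply: (fset_card_inj (F := F)) => f g fn gn FE.
  apply/val_inj/funext => x /=; have [i ix] := xsP x.
  by rewrite (FP f fn i x ix) (FP g gn i x ix) FE.
rewrite !card_ffun !card_ord -expnM -expnMn -/k.
have [->|k0] := posnP k; first by rewrite !expn0.
by rewrite leq_exp2r// mul2n -addnn -addn1 leq_add2l.
Qed.

End FullGroupGrowth.

(** * Folner function and growth *)

(** It suffices to find c >= 2 k with a c^k < 2^c: then passing from N = 1 to N
multiplies the right side by 2^(c (N - 1)) and the left side by
N^(2 k) <= 2^(2 k (N - 1)). *)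
Lemma exp_beats_poly (a k : nat) : exists c : nat, (0 < c)%N /\
  forall N : nat, (0 < N)%N -> (a * (c * N ^ 2) ^ k < 2 ^ (c * N))%N.
Proof.
have n2 n : (n < 2 ^ n)%N by exact: ltn_expl.
(* c := 2^s reduces a c^k < 2^c to a + s k < 2^s, and s = 2 u allows the bound
   (u + 1)^2 <= 2^s. *)
pose u := (a + 2 * k)%N; pose s := (2 * u)%N.
have as2 : (a + s * k < 2 ^ s)%N.
  have u1 : (u.+1 ^ 2 <= 2 ^ s)%N.
    by rewrite /s mulnC expnM leq_exp2r.
  apply: leq_trans u1; rewrite /s /u; nia.
have [c [c0 ac ck]] : exists c,
    [/\ (0 < c)%N, (a * c ^ k < 2 ^ c)%N & (2 * k <= c)%N].
  exists (2 ^ s)%N; split; first by rewrite expn_gt0.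
    rewrite -expnM; apply: (@leq_trans (2 ^ (a + s * k))).
      by rewrite expnD ltn_pmul2r ?expn_gt0.
    by rewrite leq_exp2l// ltnW.
  by have := n2 s; rewrite /s /u; lia.
exists c; split=> // -[//|N] _.
rewrite expnMn -expnM mulnA mulnS [(2 ^ _)%N]expnD.
apply: (@leq_trans (2 ^ c * (2 ^ N) ^ (2 * k))).
  have [->|k0] := posnP (2 * k); first by rewrite !expn0 !muln1.
  apply: (@leq_ltn_trans (a * c ^ k * (2 ^ N) ^ (2 * k))).
    by rewrite leq_mul2l leq_exp2r// n2 orbT.
  by rewrite ltn_pmul2r// expn_gt0 expn_gt0.
by rewrite leq_mul2l -expnM leq_exp2l// mulnC leq_mul2r ck !orbT.
Qed.

Lemma bernoulli_ineq (R : realDomainType) (x : R) n :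
  0 <= x -> 1 + n%:R * x <= (1 + x) ^+ n.
Proof.
move=> x0; elim: n => [|n IHn]; first by rewrite mul0r addr0 expr0.
rewrite exprS -natr1; have : 0 <= n%:R * x * x by rewrite !mulr_ge0.
have : (1 + x) * (1 + n%:R * x) <= (1 + x) * (1 + x) ^+ n.
  by rewrite ler_wpM2l// addr_ge0.
by move: (_ ^+ n) => y; lra.
Qed.

Section FolnerOfGrowth.
Context (G : groupType).
Implicit Types (T F S : {fset G}).

Lemma word_ballS T n : (word_ball T n `<=` word_ball T n.+1)%fset.
Proof. exact: fsubsetUl. Qed.

Lemma word_ball_mono T m n :
  (m <= n)%N -> (word_ball T m `<=` word_ball T n)%fset.
Proof.
elim: n => [|n IHn]; first by rewrite leqn0 => /eqP ->.
rewrite leq_eqVlt => /orP[/eqP ->//|mn].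
by apply: fsubset_trans (word_ballS T n); exact: IHn.
Qed.

Lemma word_ball_generated T n : [set` word_ball T n] `<=` generated [set` T].
Proof.
move=> f /= fn H [[H1 HM HV] TH]; elim: n f fn => [f|n IHn f] /=.
  by rewrite inE => /eqP ->.
rewrite inE => /orP[/IHn//|/imfset2P[t /= tT [g gn ->]]].
by apply: HM; [exact: TH|exact: IHn].
Qed.

(** An element of the smaller ball is moved by [T] inside the larger one, hence
is not on the boundary of the latter. *)
Lemma word_ball_boundary Gam T n :
  (#|` interior_boundary Gam T (word_ball T n.+1)| + #|` word_ball T n|
   <= #|` word_ball T n.+1|)%N.
Proof.
rewrite -cardfsUI.
rewrite (_ : (_ `&` _)%fset = fset0) ?cardfs0 ?addn0.
  by apply: fsubset_leq_card; rewrite fsubUset word_ballS andbT fset_sub.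
apply/fsetP => g; rewrite !inE; apply/negbTE/negP => /andP[/andP[_ /asboolP]].
move=> [_ [[t /= tT <-] [_ /= ntg]]] gn; apply: ntg.
by rewrite inE; apply/orP; right; apply/imfset2P; exists t => //; exists g.
Qed.

(** With b' the size of the next ball and b that of the current one, a boundary
larger than eps b' gives b < (1 - eps) b', so that (1 + eps) b <= b'. *)
Lemma growth_gap (R : realType) T (Gam : set G) (eps : R) L :
  0 < eps -> eps <= 1 ->
  (forall n, (n < L)%N -> eps * #|` word_ball T n.+1|%:R <
     #|` interior_boundary Gam T (word_ball T n.+1)|%:R) ->
  (1 + eps) ^+ L <= #|` word_ball T L|%:R.
Proof.
move=> e0 e1; elim: L => [|L IHL] gap; first by rewrite expr0 cardfs1.
have {}IHL := IHL (fun n nL => gap n (ltnW nL)).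
have := gap L (ltnSn L); have := word_ball_boundary Gam T L.
set b := #|` interior_boundary _ _ _|; rewrite -(ler_nat R) natrD => bL gapL.
rewrite exprS; apply: (@le_trans _ _ ((1 + eps) * #|` word_ball T L|%:R)).
  by rewrite ler_wpM2l// addr_ge0// ltW.
have : 0 <= #|` word_ball T L|%:R :> R by [].
nra.
Qed.

(** For eps >= 1 the singleton of the identity is good enough. For eps < 1 put
N = ceil (m / eps) and L = c N^2, with c given by [exp_beats_poly]. As N eps >=
1, a factor 1 + eps at each step would yield
(1 + eps)^L >= (1 + N eps)^(c N) >= 2^(c N) > a L^k elements in the ball of
radius L. So some ball of radius at most L is good, and it has at most
a L^k = (a c^k) N^(2 k) elements; since a c^k < m <= N this is at most
N^(2 k + 1). *)
Lemma folner_of_growth (R : realType) T (a k : nat) :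
  (forall n, (0 < n)%N -> (#|` word_ball T n| <= a * n ^ k)%N) ->
  exists l m : nat, [/\ (0 < l)%N, (0 < m)%N & forall eps : R, 0 < eps ->
    (folner (generated [set` T]) T eps <=
     ((Num.ceil (m%:R / Num.min 1 eps))%:~R ^+ l)%:E)%E].
Proof.
move=> grow; have [c [c0 cP]] := exp_beats_poly a k.
exists (2 * k).+1, (a * c ^ k).+1; split=> // eps e0.
have [e1|e1] := leP 1 eps.
  apply: (@le_trans _ _ 1%:E); last first.
    rewrite lee_fin divr1; apply: exprn_ege1.
    by apply: le_trans (ceil_ge _); rewrite ler1n.
  apply: ereal_inf_lbound; exists [fset 1%g]%fset; rewrite ?cardfs1//.
  split; first by apply/fset0Pn; exists 1%g; rewrite inE.
    by move=> x /=; rewrite inE => /eqP -> H [[H1 _ _] _].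
  rewrite cardfs1 mulr1; apply: le_trans e1; rewrite lern1.
  by rewrite -(cardfs1 (1%g : G)); apply: fsubset_leq_card; exact: fset_sub.
set m := (a * c ^ k).+1; set N := `|Num.ceil (m%:R / eps)|%N.
have mN0 : 0 <= m%:R / eps by rewrite divr_ge0// ltW.
have -> : (Num.ceil (m%:R / eps))%:~R = N%:R :> R.
  by rewrite /N natr_absz ger0_norm// ceil_ge0 (lt_le_trans _ mN0)// ltrN10.
have mN : m%:R / eps <= N%:R.
  rewrite /N natr_absz ger0_norm; first exact: ceil_ge.
  by rewrite ceil_ge0 (lt_le_trans _ mN0)// ltrN10.
have mleN : (m <= N)%N.
  rewrite -(ler_nat R); apply: le_trans mN.
  by rewrite ler_pdivlMr// ler_piMr// ltW.
have N0 : (0 < N)%N by exact: leq_trans mleN.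
have Neps : 1 <= N%:R * eps.
  rewrite -ler_pdivrMr//; apply: le_trans mN.
  by rewrite ler_wpM2r ?invr_ge0 ?ler1n// ltW.
pose L := (c * N ^ 2)%N.
have L0 : (0 < L)%N by rewrite muln_gt0 c0 expn_gt0 N0.
have [n nL Fn] : exists2 n, (n < L)%N &
    #|` interior_boundary (generated [set` T]) T (word_ball T n.+1)|%:R
      <= eps * #|` word_ball T n.+1|%:R.
  apply: contrapT => noF.
  have : (1 + eps) ^+ L <= #|` word_ball T L|%:R.
    apply: (@growth_gap R T (generated [set` T])) => // [|n nL].
      exact: ltW.
    by rewrite ltNge; apply/negP => Fn; apply: noF; exists n.
  apply/negP; rewrite -ltNge.
  apply: (@lt_le_trans _ _ (2 ^+ (c * N))).
    rewrite -natrX ltr_nat; apply: leq_ltn_trans (cP N N0); exact: grow.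
  have -> : L = (N * (c * N))%N by rewrite /L mulnCA.
  rewrite [leRHS]exprM lerXn2r// ?nnegrE//.
    by rewrite exprn_ge0// addr_ge0// ltW.
  apply: le_trans (bernoulli_ineq N (ltW e0)).
  by move: Neps; lra.
apply: (@le_trans _ _ (#|` word_ball T n.+1|%:R)%:E).
  apply: ereal_inf_lbound; exists (word_ball T n.+1) => //; split=> //.
    apply/fset0Pn; exists 1%g.
    by apply: (fsubsetP (word_ball_mono T (leq0n n.+1))); rewrite inE.
  exact: word_ball_generated.
rewrite lee_fin -natrX ler_nat.
apply: (@leq_trans #|` word_ball T L|).
  by apply: fsubset_leq_card; exact: word_ball_mono.
apply: leq_trans (grow _ L0) _; rewrite /L expnMn -expnM mulnA expnSr mulnC.
by rewrite leq_mul2l orbC (leq_trans _ mleN)// .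
Qed.

End FolnerOfGrowth.

Lemma cantor_set_compact (X : topologicalType) :
  cantor_set X -> compact [set: X].
Proof.
move=> [f [fc [g [_ fK gK]]]].
have -> : [set: X] = f @` [set: cantor_space].
  by apply/seteqP; split=> // x _; exists (g x).
apply: continuous_compact cantor_space_compact.
exact: continuous_subspaceT.
Qed.

(* For eps > C the real d-th root of 1 - eps / C is not defined for even d; the
   radicand is then read as 0 (there the Folner function is 1 anyway). *)
Theorem corollary1p2 (R : realType) (I : countType) (X : metricType R)
    (alpha : int_dsum I -> X -> X) (T : {fset homeo X}) :
  cantor_set X ->
  continuous_action alpha ->
  distal alpha ->
  dense [set x | free_point alpha x] ->
  [set` T] `<=` full_group alpha ->
  symmetric_fset T ->
  let Gam := generated [set` T] in
  (exists l m d C : nat,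
     [/\ (0 < l)%N, (0 < m)%N, (0 < d)%N, (0 < C)%N &
      forall eps : R, 0 < eps ->
        (folner Gam T eps <=
         ((Num.ceil (m%:R /
             (1 - Num.max 0 (1 - eps / C%:R) `^ (d%:R^-1))))%:~R
           ^+ (d * l))%:E)%E]) /\
  polynomial_growth Gam.
Proof.
move=> /cantor_set_compact Xco act dist _ TG Tsym Gam.
have [a [k grow]] := full_group_growth Xco act dist TG.
split; last by exists T; split=> //; exists a, k.
have [l [m [l0 m0 fol]]] := folner_of_growth R grow.
exists l, m, 1%N, 1%N; split=> // eps e0.
have -> : 1 - Num.max 0 (1 - eps / 1%:R) `^ 1%:R^-1 = Num.min 1 eps.
  rewrite divr1 invr1 powRr1 ?le_max ?lexx//.
  by case: (leP 1 eps) => e1; [rewrite max_l|rewrite max_r]; lra.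
by rewrite mul1n; exact: fol.
Qed.
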